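(* The subspaces $\mathfrak{E}_2^S$ (totally symmetric elements) and $\mathfrak{E}_2^A$ (totally antisymmetric elements) are subalgebras of $(\mathfrak{E}_2,* )$, and each of them is isomorphic as an algebra to $(\mathfrak{H}^1,* )$.
   Context: $\mathfrak{E}_2$ is the $\mathbb{Q}$-vector space with basis the words (including the empty word $1$) in noncommuting letters $z_{n,p}$, $n\in\{1,2,\dots\}$, $p\in\{0,1\}$, with bilinear product $*$ defined by $w*1=1*w=w$ and $aw_1*bw_2=a(w_1*bw_2)+b(aw_1*w_2)+(a\circ b)(w_1*w_2)$ for letters $a,b$ and words $w_1,w_2$, where $z_{n_1,p_1}\circ z_{n_2,p_2}=z_{n_1+n_2,p_1+p_2}$ with the second index taken mod 2. For $u\in\mathfrak{E}_2$ and a word $w$ let $\mathrm{coeff}_u(w)$ be the coefficient of $w$ in $u$. $u$ is totally symmetric if $\mathrm{coeff}_u(z_{n_1,p_1}\cdots z_{n_k,p_k})=\mathrm{coeff}_u(z_{n_1,0}\cdots z_{n_k,0})$ for all words, and totally antisymmetric if $\mathrm{coeff}_u(z_{n_1,p_1}\cdots z_{n_k,p_k})=(-1)^{p_1+\cdots+p_k}\mathrm{coeff}_u(z_{n_1,0}\cdots z_{n_k,0})$ for all words. $\mathfrak{H}^1$ is the $\mathbb{Q}$-vector space on words in noncommuting letters $z_1,z_2,\dots$ with product $w*1=1*w=w$, $z_iw_1*z_jw_2=z_i(w_1*z_jw_2)+z_j(z_iw_1*w_2)+z_{i+j}(w_1*w_2)$. *)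

(* Defs.v *)
From HB Require Import structures.
From mathcomp Require Import all_boot all_algebra finmap zify.
From mathcomp Require Import boolp.
From mathcomp.multinomials Require Import monalg.

Set Implicit Arguments.
Unset Strict Implicit.
Unset Printing Implicit Defensive.

Import GRing.Theory.
Local Open Scope ring_scope.

(* The value at u of the rat-linear map that sends each basis element << k >> *)
(* of {malg rat[K]} to f k.                                                   *)
Definition lext (K : choiceType) (V : lmodType rat) (f : K -> V)
    (u : {malg rat[K]}) : V :=
  \sum_(k <- msupp u) u@_k *: f k.

Section LinearExtension.
Variables (K : choiceType) (V : lmodType rat).
Implicit Types (f g : K -> V) (u : {malg rat[K]}).

Lemma lextEw (d : {fset K}) f u :
  (msupp u `<=` d)%fset -> lext f u = \sum_(k <- d) u@_k *: f k.
Proof.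
move=> le_d; rewrite /lext (big_fset_incl _ le_d) //= => k _ /mcoeff_outdom ->.
by rewrite scale0r.
Qed.

Lemma lext_is_linear f : linear (lext f).
Proof.
move=> a u v; pose d := (msupp u `|` msupp v)%fset.
have le_d : (msupp (a *: u + v)%R `<=` d)%fset.
  apply: (fsubset_trans (msuppD_le _ _)).
  by apply: fsetUSS => //; apply: msuppZ_le.
rewrite (lextEw f le_d) (lextEw f (fsubsetUl _ _ : msupp u `<=` d)%fset).
rewrite (lextEw f (fsubsetUr _ _ : msupp v `<=` d)%fset).
rewrite scaler_sumr -big_split /=; apply: eq_bigr => k _.
by rewrite mcoeffD mcoeffZ scalerDl scalerA.
Qed.

HB.instance Definition _ f :=
  GRing.isLinear.Build rat {malg rat[K]} V *:%R (lext f) (lext_is_linear f).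

Lemma lextU f k : lext f << k >> = f k.
Proof.
have le_k : (msupp (<< k >> : {malg rat[K]}) `<=` [fset k])%fset.
  exact: msuppU_le.
by rewrite (lextEw f le_k) big_seq_fset1 mcoeffUU scale1r.
Qed.

Lemma eq_lext f g : f =1 g -> lext f =1 lext g.
Proof. by move=> fg u; apply: eq_bigr => k _; rewrite fg. Qed.

Lemma malg_lin_ind (P : {malg rat[K]} -> Prop) :
  P 0 -> (forall k, P << k >>) ->
  (forall a u v, P u -> P v -> P (a *: u + v)) -> forall u, P u.
Proof.
move=> P0 PU PD u; rewrite [u]monalgE.
elim/big_rec: _ => // k v _ Pv.
suff -> : << u@_k *g k >> = u@_k *: << k >> :> {malg rat[K]} by apply: PD.
by apply/malgP => l; rewrite mcoeffZ !mcoeffU; case: eqP => _;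
  rewrite ?mulr1 ?mulr0.
Qed.

End LinearExtension.

Section AssociativityStep.
Variables (V : zmodType) (L : Type) (circ : L -> L -> L).
Variables (mul : V -> V -> V) (pre : L -> V -> V).
Hypothesis mulDl : left_distributive mul +%R.
Hypothesis mulDr : right_distributive mul +%R.
Hypothesis preD : forall a u v, pre a (u + v) = pre a u + pre a v.
Hypothesis mul_pre : forall a b u v,
  mul (pre a u) (pre b v) =
    pre a (mul u (pre b v)) + pre b (mul (pre a u) v)
      + pre (circ a b) (mul u v).
Hypothesis circA : associative circ.

Lemma qsh_assoc_step a b c u v w :
  let au := pre a u in let bv := pre b v in let cw := pre c w in
  mul u (mul bv cw) = mul (mul u bv) cw ->
  mul au (mul v cw) = mul (mul au v) cw ->
  mul au (mul bv w) = mul (mul au bv) w ->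
  mul u (mul v cw) = mul (mul u v) cw ->
  mul u (mul bv w) = mul (mul u bv) w ->
  mul au (mul v w) = mul (mul au v) w ->
  mul u (mul v w) = mul (mul u v) w ->
  mul au (mul bv cw) = mul (mul au bv) cw.
Proof.
move=> au bv cw E1 E2 E3 E12 E13 E23 E123.
transitivity (pre a (mul u (mul bv cw)) + pre b (mul au (mul v cw))
    + pre c (mul au (mul bv w)) + pre (circ a b) (mul u (mul v cw))
    + pre (circ a c) (mul u (mul bv w)) + pre (circ b c) (mul au (mul v w))
    + pre (circ a (circ b c)) (mul u (mul v w))).
  rewrite [mul bv cw]mul_pre !mulDr !mul_pre !preD.
  by rewrite [LHS](AC (3*3*3) ((1*4*7)*2*5*3*6*8*9)).
rewrite E1 E2 E3 E12 E13 E23 E123.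
rewrite [mul au bv]mul_pre !mulDl !mul_pre !preD circA.
by rewrite [RHS](AC (3*3*3) (1*4*(2*5*8)*7*3*6*9)).
Qed.

End AssociativityStep.

Section Words.
Variables (L : choiceType) (circ : SemiGroup.com_law L).

Definition prepend (a : L) : {malg rat[seq L]} -> {malg rat[seq L]} :=
  lext (fun w => << a :: w >>).

Fixpoint qsh_word (w1 : seq L) : seq L -> {malg rat[seq L]} :=
  if w1 is a :: w1' then
    fix qsh_word_aw1 (w2 : seq L) : {malg rat[seq L]} :=
      if w2 is b :: w2' then
        prepend a (qsh_word w1' w2) + prepend b (qsh_word_aw1 w2')
          + prepend (circ a b) (qsh_word w1' w2')
      else << w1 >>
  else fun w2 => << w2 >>.

Definition qsh_mul (u v : {malg rat[seq L]}) : {malg rat[seq L]} :=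
  lext (fun w1 => lext (qsh_word w1) v) u.

Let prependU a w : prepend a << w >> = << a :: w >>.
Proof. exact: lextU. Qed.

HB.instance Definition _ a := GRing.Linear.on (prepend a).

Lemma prependD a u v : prepend a (u + v) = prepend a u + prepend a v.
Proof. exact: raddfD. Qed.

Lemma qsh_mulPl a u1 u2 v :
  qsh_mul (a *: u1 + u2) v = a *: qsh_mul u1 v + qsh_mul u2 v.
Proof. exact: lext_is_linear. Qed.

Lemma qsh_mulPr a u v1 v2 :
  qsh_mul u (a *: v1 + v2) = a *: qsh_mul u v1 + qsh_mul u v2.
Proof.
rewrite /qsh_mul /lext scaler_sumr -big_split; apply: eq_bigr => w _ /=.
rewrite -!/(lext _ _) lext_is_linear scalerDr !scalerA.
by rewrite [in RHS]mulrC.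
Qed.

Lemma qsh_mulUU w1 w2 : qsh_mul << w1 >> << w2 >> = qsh_word w1 w2.
Proof. by rewrite /qsh_mul !lextU. Qed.

Lemma qsh_mul0l v : qsh_mul 0 v = 0.
Proof. exact: (raddf0 (lext _)). Qed.

Lemma qsh_mul0r u : qsh_mul u 0 = 0.
Proof.
by rewrite /qsh_mul /lext big1 // => w _; rewrite -/(lext _ _) raddf0 scaler0.
Qed.

Lemma qsh_mulDl : left_distributive qsh_mul +%R.
Proof. by move=> u v w; have := qsh_mulPl 1 u v w; rewrite !scale1r. Qed.

Lemma qsh_mulDr : right_distributive qsh_mul +%R.
Proof. by move=> u v w; have := qsh_mulPr 1 u v w; rewrite !scale1r. Qed.

Lemma qsh_mulZl a u v : a *: qsh_mul u v = qsh_mul (a *: u) v.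
Proof. by have := qsh_mulPl a u 0 v; rewrite qsh_mul0l !addr0. Qed.

Lemma qsh_mulZr a u v : a *: qsh_mul u v = qsh_mul u (a *: v).
Proof. by have := qsh_mulPr a u v 0; rewrite qsh_mul0r !addr0. Qed.

Lemma qsh_word_nilr w : qsh_word w [::] = << w >>.
Proof. by case: w. Qed.

Lemma qsh_mul1l : left_id << [::] >> qsh_mul.
Proof.
move=> u; rewrite /qsh_mul lextU; elim/malg_lin_ind: u => [|w|a u v Hu Hv].
- by rewrite raddf0.
- by rewrite lextU.
- by rewrite linearP /= Hu Hv.
Qed.

Lemma qsh_word_cons a b w1 w2 :
  qsh_word (a :: w1) (b :: w2) =
    prepend a (qsh_word w1 (b :: w2)) + prepend b (qsh_word (a :: w1) w2)
      + prepend (circ a b) (qsh_word w1 w2).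
Proof. by []. Qed.

Local Opaque prepend qsh_word.

Lemma qsh_wordC w1 w2 : qsh_word w1 w2 = qsh_word w2 w1.
Proof.
elim: w1 w2 => [|a w1 IH1] w2; first by rewrite qsh_word_nilr.
elim: w2 => [|b w2 IH2]; first by rewrite qsh_word_nilr.
rewrite (qsh_word_cons a b) (qsh_word_cons b a) IH2 (IH1 w2) (IH1 (b :: w2)).
by rewrite [prepend a _ + _]addrC SemiGroup.opC.
Qed.

Lemma qsh_mulC : commutative qsh_mul.
Proof.
move=> u v; elim/malg_lin_ind: u => [|w1|a u1 u2 IH1 IH2].
- by rewrite qsh_mul0l qsh_mul0r.
- elim/malg_lin_ind: v => [|w2|a v1 v2 IH1 IH2].
  + by rewrite qsh_mul0l qsh_mul0r.
  + by rewrite !qsh_mulUU qsh_wordC.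
  + by rewrite qsh_mulPl qsh_mulPr IH1 IH2.
- by rewrite qsh_mulPl qsh_mulPr IH1 IH2.
Qed.

Lemma qsh_mul1r : right_id << [::] >> qsh_mul.
Proof. by move=> u; rewrite qsh_mulC qsh_mul1l. Qed.

Lemma qsh_mul_prepend a b u v :
  qsh_mul (prepend a u) (prepend b v) =
    prepend a (qsh_mul u (prepend b v)) + prepend b (qsh_mul (prepend a u) v)
      + prepend (circ a b) (qsh_mul u v).
Proof.
elim/malg_lin_ind: u => [|w1|c u1 u2 IH1 IH2].
- by rewrite !(raddf0, qsh_mul0l, addr0).
- elim/malg_lin_ind: v => [|w2|c v1 v2 IH1 IH2].
  + by rewrite !(raddf0, qsh_mul0r, addr0).
  + by rewrite !prependU !qsh_mulUU.
  + rewrite !(linearP, qsh_mulPr) /= IH1 IH2 !scalerDr.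
    by rewrite [LHS]addrACA; congr (_ + _); rewrite addrACA.
- rewrite !(linearP, qsh_mulPl) /= IH1 IH2 !scalerDr.
  by rewrite [LHS]addrACA; congr (_ + _); rewrite addrACA.
Qed.

Lemma qsh_wordA w1 w2 w3 :
  qsh_mul << w1 >> (qsh_mul << w2 >> << w3 >>) =
  qsh_mul (qsh_mul << w1 >> << w2 >>) << w3 >>.
Proof.
have [n] := ubnP (size w1 + size w2 + size w3)%N.
elim: n w1 w2 w3 => [|n IH] w1 w2 w3; first by rewrite ltn0.
move=> le_n.
case: w1 le_n => [_|a w1]; first by rewrite (qsh_mul1l << w2 >>) qsh_mul1l.
case: w2 => [_|b w2]; first by rewrite (qsh_mul1l << w3 >>) qsh_mul1r.
case: w3 => [_|c w3 le_n]; first by rewrite (qsh_mul1r << b :: w2 >>) qsh_mul1r.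
rewrite -(prependU a w1) -(prependU b w2) -(prependU c w3).
apply: (qsh_assoc_step qsh_mulDl qsh_mulDr prependD qsh_mul_prepend
          (@SemiGroup.opA _ circ));
  rewrite ?(prependU a w1) ?(prependU b w2) ?(prependU c w3);
  by apply: IH; move: le_n => /=; lia.
Qed.

Lemma qsh_mulA : associative qsh_mul.
Proof.
move=> u v w; elim/malg_lin_ind: u => [|w1|a u1 u2 IH1 IH2].
- by rewrite !qsh_mul0l.
- elim/malg_lin_ind: v => [|w2|a v1 v2 IH1 IH2].
  + by rewrite !(qsh_mul0l, qsh_mul0r).
  + elim/malg_lin_ind: w => [|w3|a x1 x2 IH1 IH2].
    * by rewrite !qsh_mul0r.
    * exact: qsh_wordA.
    * by rewrite 3!qsh_mulPr IH1 IH2.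
  + by rewrite !(qsh_mulPl, qsh_mulPr) IH1 IH2.
- by rewrite !qsh_mulPl IH1 IH2.
Qed.

Lemma qsh_1_neq0 : << [::] >> != 0 :> {malg rat[seq L]}.
Proof. by rewrite monalgU_eq0 oner_eq0. Qed.

End Words.

Definition quasi_shuffle (L : choiceType) (circ : SemiGroup.com_law L) : Type :=
  {malg rat[seq L]}.

Section QuasiShuffleAlgebra.
Variables (L : choiceType) (circ : SemiGroup.com_law L).

HB.instance Definition _ := GRing.Lmodule.copy (quasi_shuffle circ)
  {malg rat[seq L]}.

HB.instance Definition _ := GRing.Zmodule_isComNzRing.Build
  (quasi_shuffle circ) (qsh_mulA circ) (qsh_mulC circ) (qsh_mul1l circ)
  (qsh_mulDl circ) (@qsh_1_neq0 L).

HB.instance Definition _ := GRing.Lmodule_isLalgebra.Build rat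
  (quasi_shuffle circ) (qsh_mulZl circ).

HB.instance Definition _ :=
  GRing.Lalgebra_isComAlgebra.Build rat (quasi_shuffle circ).

End QuasiShuffleAlgebra.

Definition posnat : Type := {n : nat | (0 < n)%N}.
HB.instance Definition _ := Choice.on posnat.

Definition addp (m n : posnat) : posnat :=
  exist _ (val m + val n)%N (ltn_addr _ (valP m)).

Lemma addpA : associative addp.
Proof. by move=> m n k; apply: val_inj; rewrite /= addnA. Qed.

Lemma addpC : commutative addp.
Proof. by move=> m n; apply: val_inj; rewrite /= addnC. Qed.

HB.instance Definition _ := SemiGroup.isComLaw.Build posnat addp addpA addpC.

(* (n, p) is the letter z_{n,p}; the second index is added in 'Z_2. *)
Definition letter2 : Type := (posnat * 'Z_2)%type.
HB.instance Definition _ := Choice.on letter2.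

Definition circ2 (a b : letter2) : letter2 := (addp a.1 b.1, a.2 + b.2).

Lemma circ2A : associative circ2.
Proof. by move=> a b c; rewrite /circ2 /= addpA addrA. Qed.

Lemma circ2C : commutative circ2.
Proof. by move=> a b; rewrite /circ2 addpC addrC. Qed.

HB.instance Definition _ :=
  SemiGroup.isComLaw.Build letter2 circ2 circ2A circ2C.

Definition H1 : Type := quasi_shuffle addp.
HB.instance Definition _ := GRing.ComAlgebra.on H1.

Definition E2 : Type := quasi_shuffle circ2.
HB.instance Definition _ := GRing.ComAlgebra.on E2.

Definition coeff (u : E2) (w : seq letter2) : rat := mcoeff w u.

Definition zero_parities (w : seq letter2) : seq letter2 :=
  [seq (a.1, 0) | a <- w].

Definition totally_symmetric (u : E2) : Prop :=
  forall w, coeff u w = coeff u (zero_parities w).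

(* a.2 : 'Z_2 is coerced to nat, so the exponent is p_1 + ... + p_k. *)
Definition totally_antisymmetric (u : E2) : Prop :=
  forall w, coeff u w =
    (-1) ^+ (\sum_(a <- w) a.2) * coeff u (zero_parities w).

Definition E2S : {pred E2} := [pred u | `[< totally_symmetric u >]].
Definition E2A : {pred E2} := [pred u | `[< totally_antisymmetric u >]].

(* When S is a unital subalgebra of B: A is isomorphic to S as a unital       *)
(* rat-algebra, the isomorphism being composed with the inclusion of S in B.  *)
Definition alg_isomorphic_to (A B : algType rat) (S : {pred B}) : Prop :=
  exists f : {lrmorphism A -> B},
    injective f /\ (forall y, y \in S <-> exists x, f x = y).

(* Main.v *)
Require Import Defs.
From HB Require Import structures.
From mathcomp Require Import all_boot all_algebra ring.
From mathcomp Require Import boolp.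
From mathcomp.multinomials Require Import monalg.

(** For a character chi of Z/2, the elements e_n = (1/2) sum_p chi(p) z_{n,p}
    satisfy e_m o e_n = e_{m+n}: the sum over p + q = r has two terms, which
    the factor 1/2 compensates. Hence z_n |-> e_n extends letter by letter to
    an algebra morphism from H^1 to E_2, and the coefficient of its value at
    u on the word z_{n_1,p_1}...z_{n_k,p_k} is
    2^-k chi(p_1)...chi(p_k) coeff_u(z_{n_1}...z_{n_k}). This morphism is
    thus injective, with image the elements whose coefficients transform
    under chi, and an image of an algebra morphism is a subalgebra. The
    trivial character yields the symmetric elements, the sign character the
    antisymmetric ones. *)

Set Implicit Arguments.
Unset Strict Implicit.
Unset Printing Implicit Defensive.

Import GRing.Theory.
Local Open Scope ring_scope.

(** * Images of algebra morphisms, and coefficients *)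

Lemma alg_isomorphic_to_subalg_closed (A B : algType rat) (S : {pred B}) :
  alg_isomorphic_to A S -> GRing.subalg_closed S.
Proof.
move=> [f [_ imf]]; split.
- by apply/imf; exists 1; rewrite rmorph1.
- move=> a _ _ /imf[x <-] /imf[y <-].
  by apply/imf; exists (a *: x + y); rewrite linearP.
- move=> _ _ /imf[x <-] /imf[y <-].
  by apply/imf; exists (x * y); rewrite rmorphM.
Qed.

Lemma mcoeffZU (K : choiceType) (a : rat) (k l : K) :
  mcoeff l (a *: << k >> : {malg rat[K]}) = a * (k == l)%:R.
Proof. by rewrite mcoeffZ mcoeffU. Qed.

Lemma mcoeff_prepend (L : choiceType) (a : L) (u : {malg rat[seq L]}) w :
  mcoeff w (prepend a u) =
    if w is b :: w' then (a == b)%:R * mcoeff w' u else 0.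
Proof.
elim/malg_lin_ind: u => [|v|c u1 u2 IH1 IH2].
- by rewrite raddf0 mcoeff0; case: w => // b w; rewrite mcoeff0 mulr0.
- rewrite /prepend lextU mcoeffU; case: w => // b w.
  by rewrite mcoeffU eqseq_cons -mulnb natrM.
- rewrite linearP /= mcoeffD mcoeffZ IH1 IH2; case: w {IH1 IH2} => [|b w].
    by rewrite mulr0 addr0.
  by rewrite mcoeffD mcoeffZ mulrDr mulrCA.
Qed.

Lemma mcoeff_qshP (L : choiceType) (circ : SemiGroup.com_law L)
    (a : rat) (u v : quasi_shuffle circ) w :
  mcoeff w (a *: u + v) = a * mcoeff w u + mcoeff w v.
Proof. by rewrite [LHS]mcoeffD [mcoeff w (_ *: _)]mcoeffZ. Qed.

Lemma coeffZ (a : rat) (u : E2) w : coeff (a *: u) w = a * coeff u w.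
Proof. exact: mcoeffZ. Qed.

Lemma coeff_sum (I : finType) (F : I -> E2) w :
  coeff (\sum_i F i) w = \sum_i coeff (F i) w.
Proof. exact: (raddf_sum (mcoeff w)). Qed.

(** * The morphism attached to a character of Z/2 *)

Section Character.
Variable chi : 'Z_2 -> rat.
Hypothesis chi0 : chi 0 = 1.
Hypothesis chiD : forall p q, chi (p + q) = chi p * chi q.

Definition chi_word (w : seq letter2) : rat := \prod_(a <- w) chi a.2.

(** Left concatenation with e_n, which is a combination of letters rather than a letter. *)
Definition chi_prepend (n : posnat) (v : E2) : E2 :=
  2%:R^-1 *: \sum_(p : 'Z_2) chi p *: (prepend (n, p) v : E2).

Lemma chi_prepend_is_linear n : linear (chi_prepend n).
Proof.
move=> a u v; rewrite /chi_prepend scalerA mulrC -scalerA -scalerDr.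
congr (_ *: _); rewrite scaler_sumr -big_split; apply: eq_bigr => p _ /=.
rewrite [prepend _ _](linearP (prepend (n, p))) scalerDr.
by rewrite !scalerA [chi p * a]mulrC.
Qed.

HB.instance Definition _ n :=
  GRing.isLinear.Build rat E2 E2 *:%R (chi_prepend n)
    (chi_prepend_is_linear n).

Lemma prepend_mul (a b : letter2) (u v : E2) :
  (prepend a u : E2) * (prepend b v : E2) =
    (prepend a (u * (prepend b v : E2)) : E2)
      + (prepend b ((prepend a u : E2) * v) : E2)
      + (prepend (circ2 a b) (u * v) : E2).
Proof. exact: (qsh_mul_prepend circ2). Qed.

Lemma prependZ (a : letter2) (c : rat) (u : E2) :
  prepend a (c *: u) = c *: (prepend a u : E2) :> E2.
Proof. exact: (linearZ_LR (prepend a)). Qed.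

Lemma prepend_sum (a : letter2) (F : 'Z_2 -> E2) (c : 'Z_2 -> rat) :
  prepend a (\sum_p c p *: F p) = \sum_p c p *: (prepend a (F p) : E2) :> E2.
Proof.
rewrite [LHS](raddf_sum (prepend a)); apply: eq_bigr => p _.
exact: prependZ.
Qed.

(** The e_n obey the quasi-shuffle recursion of H^1. All four terms expand as 1/4 of a double sum
    weighted by chi(p) chi(q), and the summands are related by the recursion for the letters (m,p)
    and (n,q). *)
Lemma chi_prepend_mul m n (u v : E2) :
  chi_prepend m u * chi_prepend n v =
    chi_prepend m (u * chi_prepend n v) + chi_prepend n (chi_prepend m u * v)
      + chi_prepend (addp m n) (u * v).
Proof.
have -> : chi_prepend m u * chi_prepend n v =
    (2%:R^-1 * 2%:R^-1) *: \sum_p \sum_q (chi p * chi q) *: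
      ((prepend (m, p) u : E2) * (prepend (n, q) v : E2)).
  rewrite /chi_prepend -scalerAl -scalerAr scalerA mulr_suml; congr (_ *: _).
  apply: eq_bigr => p _; rewrite mulr_sumr; apply: eq_bigr => q _.
  by rewrite -scalerAl -scalerAr scalerA.
have -> : chi_prepend m (u * chi_prepend n v) =
    (2%:R^-1 * 2%:R^-1) *: \sum_p \sum_q (chi p * chi q) *:
      (prepend (m, p) (u * (prepend (n, q) v : E2)) : E2).
  rewrite /chi_prepend -scalerA; congr (_ *: _).
  rewrite [RHS]scaler_sumr; apply: eq_bigr => p _.
  rewrite -scalerAr prependZ mulr_sumr.
  under [X in prepend _ X]eq_bigr do rewrite -scalerAr.
  rewrite prepend_sum scalerA mulrC -scalerA; congr (_ *: _).
  by rewrite scaler_sumr; apply: eq_bigr => q _; rewrite scalerA.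
have -> : chi_prepend n (chi_prepend m u * v) =
    (2%:R^-1 * 2%:R^-1) *: \sum_p \sum_q (chi p * chi q) *:
      (prepend (n, q) ((prepend (m, p) u : E2) * v) : E2).
  (* Here the letter in front is (n,q), so q has to be the outer variable. *)
  rewrite exchange_big /chi_prepend -scalerA; congr (_ *: _).
  rewrite [RHS]scaler_sumr; apply: eq_bigr => q _.
  rewrite -scalerAl prependZ mulr_suml.
  under [X in prepend _ X]eq_bigr do rewrite -scalerAl.
  rewrite prepend_sum scalerA mulrC -scalerA; congr (_ *: _).
  rewrite scaler_sumr; apply: eq_bigr => p _.
  by rewrite scalerA [chi q * _]mulrC.
have -> : chi_prepend (addp m n) (u * v) =
    (2%:R^-1 * 2%:R^-1) *: \sum_p \sum_q (chi p * chi q) *: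
      (prepend (circ2 (m, p) (n, q)) (u * v) : E2).
  rewrite /chi_prepend.
  (* For fixed p the translation q -> p + q permutes Z/2, so the inner sum does not depend on p; the
     outer sum then doubles it and cancels one factor 1/2. *)
  under [in RHS]eq_bigr => p _.
    under eq_bigr => q _ do rewrite -chiD.
    rewrite -(reindex_inj (addrI p) (P := predT) (F := fun r : 'Z_2 =>
      chi r *: (prepend (addp m n, r) (u * v) : E2))).
    over.
  rewrite sumr_const card_ord -scaler_nat scalerA.
  by rewrite -mulrA mulVf // mulr1.
rewrite -!scalerDr -!big_split; congr (_ *: _); apply: eq_bigr => p _.
rewrite -!big_split; apply: eq_bigr => q _.
by rewrite prepend_mul !scalerDr.
Qed.

Definition chi_embed : H1 -> E2 :=
  lext (foldr chi_prepend 1).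

HB.instance Definition _ := GRing.Linear.on chi_embed.

Lemma chi_embedU w : chi_embed << w >> = foldr chi_prepend 1 w.
Proof. exact: lextU. Qed.

Lemma chi_embed_prepend n (u : H1) :
  chi_embed (prepend n u) = chi_prepend n (chi_embed u).
Proof.
elim/malg_lin_ind: u => [|w|a u v IHu IHv].
- by rewrite (raddf0 (prepend n)) !raddf0.
- by rewrite [prepend _ _]lextU !chi_embedU.
- by rewrite (linearP (prepend n)) !linearP /= IHu IHv.
Qed.

(** Both sides satisfy the same recursion on the two words: [qsh_word_cons] on the left,
    [chi_prepend_mul] on the right. *)
Lemma chi_embedUM w1 w2 :
  chi_embed (qsh_word addp w1 w2) =
    foldr chi_prepend 1 w1 * foldr chi_prepend 1 w2.
Proof.
elim: w1 w2 => [|m w1 IH1] w2; first by rewrite mul1r -chi_embedU.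
elim: w2 => [|n w2 IH2]; first by rewrite mulr1 -chi_embedU.
have -> : chi_embed (qsh_word addp (m :: w1) (n :: w2)) =
    chi_prepend m (chi_embed (qsh_word addp w1 (n :: w2)))
      + chi_prepend n (chi_embed (qsh_word addp (m :: w1) w2))
      + chi_prepend (addp m n) (chi_embed (qsh_word addp w1 w2)).
  rewrite -!chi_embed_prepend -!(raddfD chi_embed).
  by rewrite -(qsh_word_cons addp).
rewrite IH2 !IH1; exact: esym (chi_prepend_mul _ _ _ _).
Qed.

Lemma chi_embedM (u v : H1) : chi_embed (u * v) = chi_embed u * chi_embed v.
Proof.
elim/malg_lin_ind: u => [|w1|a u1 u2 IH1 IH2].
- by rewrite mul0r !raddf0 mul0r.
- elim/malg_lin_ind: v => [|w2|a v1 v2 IH1 IH2].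
  + by rewrite mulr0 !raddf0 mulr0.
  + by rewrite !chi_embedU -chi_embedUM -(qsh_mulUU addp).
  + by rewrite [_ * _](qsh_mulPr addp) !linearP /= IH1 IH2 mulrDr -scalerAr.
- by rewrite [_ * v](qsh_mulPl addp) !linearP /= IH1 IH2 mulrDl -scalerAl.
Qed.

(** * Coefficients, injectivity and image of the morphism *)

Lemma coeff_chi_prepend n (v : E2) w :
  coeff (chi_prepend n v) w =
    if w is a :: w' then 2%:R^-1 * (n == a.1)%:R * chi a.2 * coeff v w' else 0.
Proof.
rewrite /chi_prepend coeffZ coeff_sum.
under eq_bigr do rewrite coeffZ /coeff mcoeff_prepend.
case: w => [|[m p] w] /=; first by rewrite big1 ?mulr0 // => p _; rewrite mulr0.
(* Only the summand whose parity is that of the first letter of the word survives. *)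
rewrite (bigD1 p) //= big1 => [|q qp]; last first.
  by rewrite xpair_eqE (negbTE qp) andbF mul0r mulr0.
by rewrite addr0 xpair_eqE eqxx andbT /coeff; ring.
Qed.

Lemma coeff_chi_embed (u : H1) w :
  coeff (chi_embed u) w =
    2%:R^-1 ^+ size w * chi_word w * mcoeff [seq a.1 | a <- w] u.
Proof.
elim/malg_lin_ind: u => [|v|a u v IHu IHv].
- by rewrite raddf0 /coeff !mcoeff0 mulr0.
- rewrite chi_embedU mcoeffU; elim: v w => [|n v IH] w /=.
    rewrite /coeff mcoeffU /chi_word; case: w => [|a w] /=.
      by rewrite big_nil !mulr1.
    by rewrite mulr0.
  rewrite coeff_chi_prepend; case: w => [|a w] /=; first by rewrite mulr0.
  rewrite IH eqseq_cons -mulnb natrM /chi_word big_cons exprS.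
  by ring.
- rewrite linearP /coeff (mcoeff_qshP (circ := circ2)) mcoeffD mcoeffZ.
  by rewrite -!/(coeff _ _) IHu IHv; ring.
Qed.

Definition zero_lift (v : seq posnat) : seq letter2 := [seq (n, 0) | n <- v].

Lemma zero_liftK v : [seq a.1 | a <- zero_lift v] = v.
Proof. by rewrite -map_comp map_id_in. Qed.

Lemma zero_lift_fst w : zero_lift [seq a.1 | a <- w] = zero_parities w.
Proof. by rewrite /zero_lift -map_comp. Qed.

Lemma chi_word_zero_lift v : chi_word (zero_lift v) = 1.
Proof. by rewrite /chi_word big_map big1. Qed.

Lemma pow2_neq0 k : (2%:R : rat) ^+ k != 0.
Proof. by rewrite expf_neq0. Qed.

(** Words of zero parity suffice: there [chi_word] is 1, so the coefficient of the image is 2^-k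
    times that of the preimage. *)
Lemma chi_embed_inj : injective chi_embed.
Proof.
move=> u v uv; apply/malgP => w.
have := coeff_chi_embed u (zero_lift w); rewrite uv coeff_chi_embed.
rewrite !zero_liftK chi_word_zero_lift mulr1 exprVn.
by move/(mulfI (invr_neq0 (pow2_neq0 _))).
Qed.

(* Sending the words with a nonzero parity to 0 makes unembed read off
   the coefficients of the preimage for every character at once. *)
Definition unembed : E2 -> H1 :=
  lext (fun w => if zero_parities w == w
                 then 2%:R ^+ size w *: << [seq a.1 | a <- w] >> else 0).

HB.instance Definition _ := GRing.Linear.on unembed.

Lemma mcoeff_unembed (y : E2) v :
  mcoeff v (unembed y) = 2%:R ^+ size v * coeff y (zero_lift v).
Proof.
elim/malg_lin_ind: y => [|w|a y z IHy IHz].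
- by rewrite raddf0 /coeff !mcoeff0 mulr0.
- rewrite [unembed _]lextU /coeff mcoeffU.
  have [->|wv] := eqVneq w (zero_lift v).
    by rewrite -zero_lift_fst zero_liftK eqxx mcoeffZU eqxx size_map.
  (* A word other than the lift of v contributes nothing: either it has a nonzero parity and is sent
     to 0, or it is the lift of its own first indices, which then differ from v. *)
  rewrite mulr0; case: eqP => [w0|_]; last by rewrite mcoeff0.
  rewrite mcoeffZU; case: eqP => [wv'|_]; last by rewrite mulr0.
  by rewrite -wv' zero_lift_fst w0 eqxx in wv.
- rewrite linearP /coeff (mcoeff_qshP (circ := addp)) mcoeffD mcoeffZ.
  by rewrite -!/(coeff _ _) IHy IHz; ring.
Qed.

(** Common form of total symmetry (chi = 1) and total antisymmetry (chi the sign). *)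
Definition chi_symmetric (y : E2) : Prop :=
  forall w, coeff y w = chi_word w * coeff y (zero_parities w).

Lemma chi_symmetricP (y : E2) :
  chi_symmetric y <-> exists x, chi_embed x = y.
Proof.
split=> [ysym | [x <-] w].
  (* The factors 2^k of [unembed] and 2^-k of [chi_embed] cancel, leaving [chi_word w] times the
     coefficient at zero parities, which is the coefficient at w by symmetry. *)
  exists (unembed y); apply/malgP => w.
  rewrite -[LHS]/(coeff _ w) coeff_chi_embed mcoeff_unembed.
  rewrite size_map zero_lift_fst -[RHS]/(coeff y w) [RHS]ysym exprVn.
  by rewrite mulrAC mulKf ?pow2_neq0 // mulrC.
rewrite !coeff_chi_embed -zero_lift_fst zero_liftK chi_word_zero_lift.
by rewrite !size_map; ring.
Qed.

Lemma chi_symmetric_iso (S : {pred E2}) :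
  (forall y, y \in S <-> chi_symmetric y) -> alg_isomorphic_to H1 S.
Proof.
move=> Schi.
have mor : monoid_morphism chi_embed.
  by split; [exact: lextU | exact: chi_embedM].
pose mul := GRing.isMonoidMorphism.Build H1 E2 chi_embed mor.
pose f : {lrmorphism H1 -> E2} := HB.pack chi_embed mul.
exists f; split; first exact: chi_embed_inj.
by move=> y; split=> [/Schi/chi_symmetricP | /chi_symmetricP/Schi].
Qed.

End Character.

(** * The trivial and the sign character *)

(** The exponent on the left is reduced mod 2, which is harmless because a power of -1 depends only
    on the parity of its exponent. *)
Lemma signZ2D (p q : 'Z_2) : (-1) ^+ (p + q)%R = (-1) ^+ p * (-1) ^+ q :> rat.
Proof. by rewrite -exprD /= -signr_odd modn2 oddb signr_odd. Qed.

Lemma E2S_iso : alg_isomorphic_to H1 E2S.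
Proof.
apply: (@chi_symmetric_iso (fun=> 1)) => // y.
rewrite inE; split=> [/asboolP ysym w|ysym].
  by rewrite /chi_word big1_eq mul1r.
by apply/asboolP => w; rewrite ysym /chi_word big1_eq mul1r.
Qed.

Lemma E2A_iso : alg_isomorphic_to H1 E2A.
Proof.
apply: (@chi_symmetric_iso (fun p => (-1) ^+ p)) => // [|y].
  exact: signZ2D.
rewrite inE; split=> [/asboolP yanti w|yanti].
  (* The product of the signs is -1 to the sum of the parities, taken in the natural numbers. *)
  by rewrite /chi_word prodrXr.
by apply/asboolP => w; rewrite yanti /chi_word prodrXr.
Qed.

Theorem theorem3p1 :
  (GRing.subalg_closed E2S /\ GRing.subalg_closed E2A) /\
  (alg_isomorphic_to H1 E2S /\ alg_isomorphic_to H1 E2A).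
Proof.
split; last by split; [exact: E2S_iso | exact: E2A_iso].
split; apply: alg_isomorphic_to_subalg_closed.
- exact: E2S_iso.
- exact: E2A_iso.
Qed.
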